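(* Let $F$ be a graph. Then $\mathrm{rex}(n,K_3,F)=O(n)$ (as $n\to\infty$, with $F$ fixed) if and only if $F$ is an extended friendship graph.
   Context: All graphs are finite and simple. $\mathcal{N}(H,G)$ denotes the number of (not necessarily induced) copies of $H$ in $G$. A graph is $F$-free if it does not contain $F$ as a (not necessarily induced) subgraph. For graphs $H,F$ and a positive integer $n$, $\mathrm{rex}(n,H,F):=\max\{\mathcal{N}(H,G): G \text{ is an } F\text{-free regular } n\text{-vertex graph}\}$. An extended friendship graph is a graph in which every cycle is a triangle and there is a vertex $v$ such that every pair of triangles intersect in $v$; equivalently, its 2-core is empty or a friendship graph (one or more triangles all sharing one common vertex and otherwise vertex-disjoint). *)

(* Defs.v *)
From HB Require Import structures.
From mathcomp Require Import all_boot.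

Set Implicit Arguments.
Unset Strict Implicit.
Unset Printing Implicit Defensive.

Record sgraph (V : finType) := SGraph {
  edges : {set {set V}};
  edges_card2 : [forall e in edges, #|e| == 2] }.

HB.instance Definition _ (V : finType) := [isSub for @edges V].
HB.instance Definition _ (V : finType) := [Equality of sgraph V by <:].
HB.instance Definition _ (V : finType) := [Choice of sgraph V by <:].
HB.instance Definition _ (V : finType) := [Countable of sgraph V by <:].
HB.instance Definition _ (V : finType) := [Finite of sgraph V by <:].

Definition adj (V : finType) (G : sgraph V) : rel V :=
  [rel x y | [set x; y] \in edges G].

Definition degree (V : finType) (G : sgraph V) (x : V) : nat :=
  #|[set e in edges G | x \in e]|.

Definition regular (V : finType) (G : sgraph V) : bool :=
  [forall x, forall y, degree G x == degree G y].

Lemma complete_card2 (k : nat) :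
  [forall e in [set e : {set 'I_k} | #|e| == 2], #|e| == 2].
Proof. by apply/forall_inP => e; rewrite inE. Qed.

Definition complete (k : nat) : sgraph 'I_k := SGraph (complete_card2 k).

Definition embedding (W V : finType) (H : sgraph W) (G : sgraph V)
    (f : {ffun W -> V}) : bool :=
  injectiveb f && [forall e in edges H, (f @: e) \in edges G].

(* A copy of H in G is a subgraph of G isomorphic to H, given by its vertex set
   and its edge set; embeddings with the same image yield the same copy. *)
Definition copies (W V : finType) (H : sgraph W) (G : sgraph V) :
    {set {set V} * {set {set V}}} :=
  [set (f @: [set: W], [set f @: (e : {set W}) | e in edges H])
     | f : {ffun W -> V} in embedding H G].

Definition ncopies (W V : finType) (H : sgraph W) (G : sgraph V) : nat :=
  #|copies H G|.

Definition free (W V : finType) (F : sgraph W) (G : sgraph V) : bool :=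
  copies F G == set0.

(* If F has an edge, the edgeless graph is always admissible. If F is edgeless,
   there is no F-free graph on n >= #|U| vertices, and the maximum over the
   empty family is 0. *)
Definition rex (n : nat) (W U : finType) (H : sgraph W) (F : sgraph U) : nat :=
  \max_(G : sgraph 'I_n | free F G && regular G) ncopies H G.

Definition is_cycle (V : finType) (G : sgraph V) (s : seq V) : Prop :=
  2 < size s /\ ucycle (adj G) s.

Definition triangle (V : finType) (G : sgraph V) (T : {set V}) : bool :=
  (#|T| == 3) && [forall x in T, forall y in T, (x != y) ==> adj G x y].

(* The graph without vertices has an empty 2-core, hence counts as an extended
   friendship graph although it has no vertex to serve as the centre v. *)
Definition extended_friendship (V : finType) (F : sgraph V) : Prop :=
  (forall s : seq V, is_cycle F s -> size s = 3) /\
  (#|V| = 0 \/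
   exists v : V, forall T1 T2 : {set V},
     triangle F T1 -> triangle F T2 -> T1 != T2 -> T1 :&: T2 = [set v]).

Definition is_O_id (f : nat -> nat) : Prop :=
  exists C N : nat, forall n : nat, N <= n -> f n <= C * n.

(* Main.v *)
Require Import Defs.
From mathcomp Require Import all_boot fingroup perm ssralg zmodp.
From mathcomp Require Import zify.

Set Implicit Arguments.
Unset Strict Implicit.
Unset Printing Implicit Defensive.

(* Let F be an extended friendship graph on m vertices and G an F-free regular
   graph. If all degrees exceed m, no vertex u can have, outside every set of at
   most m vertices, an edge in its neighbourhood: otherwise the triangles of F
   embed one after the other at u, and the rest of F, which is a forest hanging
   on them, embeds greedily. So the edges in the neighbourhood of u are covered
   by at most m vertices, trivially so if the degree is at most m, and this
   forces O(m^2 n) triangles.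

   Conversely, two disjoint triangles of F are avoided by a regular graph with
   quadratically many triangles all sharing a vertex. A cycle of F of length
   L > 3 is avoided by a Cayley graph with d generators of order 3 that satisfy
   no relation of length at most L other than the obvious ones; it has n d / 3
   triangles, with d arbitrarily large. The generators act on the ball of radius
   L in the free product of d copies of Z/3. In the absence of such cycles two
   distinct triangles of F share at most one vertex, and three of them meeting
   pairwise have a common vertex. *)

(** * Triangles and copies *)

Section Graphs.
Variable V : finType.
Implicit Types (G : sgraph V) (x y z : V) (T : {set V}).

Lemma adj_sym G : symmetric (adj G).
Proof. by move=> x y; rewrite /adj /= setUC. Qed.

Lemma adj_irrefl G : irreflexive (adj G).
Proof.
move=> x; rewrite /adj /= setUid; apply/negP => xe.
by have := forall_inP (edges_card2 G) _ xe; rewrite cards1.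
Qed.

Lemma adj_neq G x y : adj G x y -> x != y.
Proof. by apply: contraTneq => ->; rewrite adj_irrefl. Qed.

Lemma edgeP G (e : {set V}) :
  reflect (exists x y, e = [set x; y] /\ adj G x y) (e \in edges G).
Proof.
apply: (iffP idP) => [eG|[x [y [-> //]]]].
have /cards2P [x [y [xy de]]] := forall_inP (edges_card2 G) _ eG.
by exists x, y; rewrite /adj /= -de.
Qed.

Definition nbhd G x : {set V} := [set y | adj G x y].

Lemma degreeE G x : degree G x = #|nbhd G x|.
Proof.
have inj : {in nbhd G x &, injective (fun y => [set x; y])}.
  move=> y z; rewrite !inE => xy xz /setP /(_ y).
  rewrite !inE eqxx orbT; case/esym/orP => /eqP // yx.
  by rewrite yx adj_irrefl in xy.
rewrite /degree -(card_in_imset inj); apply: eq_card => e; rewrite inE.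
apply/andP/imsetP => [[/edgeP [y [z [-> yz]]]]|[y]].
  rewrite !inE => /orP [] /eqP ->; first by exists z; rewrite ?inE.
  by exists y; rewrite ?inE 1?adj_sym // setUC.
by rewrite inE => xy ->; rewrite !inE eqxx.
Qed.

Definition triangles G : {set {set V}} := [set T | triangle G T].

Lemma cards3P T : reflect (exists x y z, [/\ x != y, x != z, y != z & T = [set x; y; z]])
                          (#|T| == 3).
Proof.
apply: (iffP idP) => [cT|[x [y [z [xy xz yz ->]]]]]; last first.
  by rewrite -setUA cardsU1 cards2 !inE negb_or xy xz yz.
have /card_gt0P [x xT] : 0 < #|T| by rewrite (eqP cT).
have /cards2P [y [z [yz dT]]] : #|T :\ x| == 2 by move: cT; rewrite (cardsD1 x) xT.
have : x \notin T :\ x by rewrite !inE eqxx.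
rewrite dT !inE negb_or => /andP [xy xz].
by exists x, y, z; split; rewrite // -setUA -dT setD1K.
Qed.

Lemma triangleP G T :
  reflect (exists x y z, [/\ T = [set x; y; z], adj G x y, adj G x z & adj G y z])
          (triangle G T).
Proof.
apply: (iffP andP) => [[/cards3P [x [y [z [xy xz yz ->]]]] /forall_inP adjT]|].
  exists x, y, z; split=> //.
  - by have /forall_inP /(_ y) := adjT x ltac:(by rewrite !inE eqxx);
      rewrite !inE eqxx orbT xy => /(_ isT).
  - by have /forall_inP /(_ z) := adjT x ltac:(by rewrite !inE eqxx);
      rewrite !inE eqxx orbT xz => /(_ isT).
  - by have /forall_inP /(_ z) := adjT y ltac:(by rewrite !inE eqxx orbT);
      rewrite !inE eqxx orbT yz => /(_ isT).
move=> [x [y [z [-> xy xz yz]]]]; split.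
  by apply/cards3P; exists x, y, z; rewrite (adj_neq xy) (adj_neq xz) (adj_neq yz).
apply/forall_inP => a aT; apply/forall_inP => b bT; apply/implyP.
move: aT bT; rewrite !inE.
by case/orP=> [/orP []|] /eqP -> => /orP [/orP []|] /eqP ->;
  rewrite ?eqxx // => _; rewrite // adj_sym.
Qed.

Lemma triangle_adj G T x y :
  triangle G T -> x \in T -> y \in T -> x != y -> adj G x y.
Proof.
case/andP=> _ /forall_inP adjT xT yT xy.
by move/forall_inP: (adjT _ xT) => /(_ _ yT); rewrite xy.
Qed.

Lemma triangle_card G T : triangle G T -> #|T| = 3.
Proof. by case/andP => /eqP. Qed.

Lemma triangle_at G T x : triangle G T -> x \in T ->
  exists y z, [/\ T = [set x; y; z], adj G x y, adj G x z & adj G y z].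
Proof.
case/triangleP => [a [b [c [-> ab ac bc]]]]; rewrite !inE.
case/orP=> [/orP []|] /eqP ->.
- by exists b, c.
- by exists a, c; rewrite (adj_sym G b a); split=> //; rewrite [in RHS](setUC [set b]).
- exists a, b; rewrite !(adj_sym G c); split=> //.
  by rewrite [LHS]setUC setUA.
Qed.

Lemma card_bigcup_leq (I T : finType) (P : pred I) (A : I -> {set T}) :
  #|\bigcup_(i | P i) A i| <= \sum_(i | P i) #|A i|.
Proof.
elim/big_rec2: _ => [|i s U _ IH]; first by rewrite cards0.
by rewrite (leq_trans (leq_card_setU _ _)) ?leq_add2l.
Qed.

(** * Counting triangles when every link has a small vertex cover *)

Section LinkCovers.
Variables (G : sgraph V) (m : nat) (X : V -> {set V}).
Hypothesis card_X : forall u, #|X u| <= m.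
Hypothesis cover_X : forall u y z,
  adj G u y -> adj G u z -> adj G y z -> (y \in X u) || (z \in X u).

Let codeg u y := #|nbhd G u :&: nbhd G y|.

(** If [y] is outside [X u], then [cover_X] forces every common neighbour of [u] and [y] into [X u],
    which has at most [m] elements. *)
Let heavy_X u y : adj G u y -> m < codeg u y -> y \in X u.
Proof.
move=> uy; apply: contraTT => yX; rewrite -leqNgt.
apply: leq_trans (card_X u); apply/subset_leq_card/subsetP => z.
by rewrite !inE => /andP [uz yz]; have := cover_X uy uz yz; rewrite (negPf yX).
Qed.

(* An edge is heavy if its ends have more than m common neighbours; the heavy
   neighbours of u all lie in X u. Two of the three edges of a triangle are
   both heavy or both light, and they share a vertex u. *)
Lemma triangles_link_cover : #|triangles G| <= 2 * m * m * #|V|.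
Proof.
(* Candidates for the third vertex: it lies in [X u] when both edges at [u] are heavy, and among the
   at most [m] common neighbours when [u y] is light. *)
pose Y u y := X u :|: (if codeg u y <= m then nbhd G u :&: nbhd G y else set0).
have cardY u y : #|Y u y| <= 2 * m.
  rewrite (leq_trans (leq_card_setU _ _)) // mul2n -addnn leq_add //.
  by case: ifP; rewrite ?cards0.
pose B := \bigcup_(u : V) \bigcup_(y in X u) [set [set u; y; z] | z in Y u y].
have sub : triangles G \subset B.
  have inB u y z : y \in X u -> z \in Y u y -> [set u; y; z] \in B.
    by move=> yX zY; apply/bigcupP; exists u => //; apply/bigcupP; exists y => //;
       apply: imset_f.
  have same u y z : adj G u y -> adj G u z -> adj G y z ->
      (m < codeg u y) = (m < codeg u z) -> [set u; y; z] \in B.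
    move=> uy uz yz; case: ltnP => [hy /esym hz|ly /esym/negbT].
      by apply: inB; rewrite ?inE ?(heavy_X uy) ?(heavy_X uz).
    rewrite -leqNgt => lz; case/orP: (cover_X uy uz yz) => [yX|zX].
      by apply: inB => //; rewrite !inE ly !inE uz yz orbT.
    rewrite -setUA (setUC [set y]) setUA; apply: inB => //.
    by rewrite !inE lz !inE uy (adj_sym G z) yz orbT.
  have codegC u y : codeg u y = codeg y u by rewrite /codeg setIC.
  apply/subsetP => T; rewrite inE => /triangleP [x [y [z [-> xy xz yz]]]].
  have [e1|n1] := eqVneq (m < codeg x y) (m < codeg x z); first exact: same.
  have [e2|n2] := eqVneq (m < codeg y x) (m < codeg y z).
    by rewrite (setUC [set x]); apply: same; rewrite // adj_sym.
  have -> : [set x; y; z] = [set z; x; y] by rewrite setUC setUA.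
  apply: same; rewrite // 1?(adj_sym G z) //.
  rewrite !(codegC z); move: n1 n2; rewrite (codegC y x).
  by do 3!case: (m < _).
apply: leq_trans (subset_leq_card sub) _.
apply: leq_trans (card_bigcup_leq _ _) _.
rewrite mulnC -sum_nat_const; apply: leq_sum => u _.
apply: leq_trans (card_bigcup_leq _ _) _.
apply: (@leq_trans (\sum_(y in X u) 2 * m)).
  by apply: leq_sum => y _; apply: leq_trans (leq_imset_card _ _) _.
by rewrite sum_nat_const mulnC leq_mul.
Qed.
End LinkCovers.
End Graphs.

Lemma embeddingP (W V : finType) (H : sgraph W) (G : sgraph V) (f : {ffun W -> V}) :
  reflect (injective f /\ forall x y, adj H x y -> adj G (f x) (f y))
          (embedding H G f).
Proof.
apply: (iffP andP) => [[/injectiveP injf /forall_inP he]|[injf he]]; split=> //.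
- move=> x y xy; have := he _ xy.
  by rewrite /adj /= imsetU1 imset_set1.
- exact/injectiveP.
- apply/forall_inP => e /edgeP [x [y [-> xy]]].
  by rewrite imsetU1 imset_set1; apply: he.
Qed.

Lemma freePn (W V : finType) (H : sgraph W) (G : sgraph V) :
  reflect (exists f : W -> V,
             injective f /\ forall x y, adj H x y -> adj G (f x) (f y))
          (~~ free H G).
Proof.
rewrite /free; apply: (iffP (set0Pn _)) => [[c /imsetP [f /embeddingP [injf hf] _]]|[f [injf hf]]].
  by exists f.
exists ([ffun x => f x] @: setT, [set [ffun x => f x] @: (e : {set W}) | e in edges H]).
apply: imset_f; apply/embeddingP; split=> x y; rewrite !ffunE; first exact: injf.
exact: hf.
Qed.

Lemma adj_complete k (i j : 'I_k) : adj (complete k) i j = (i != j).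
Proof. by rewrite /adj /= inE cards2; case: (i != j). Qed.

(** The edges of a copy are all pairs of its vertices, so projecting copies to vertex sets is
    injective. *)
Lemma ncopies_K3 (V : finType) (G : sgraph V) :
  ncopies (complete 3) G = #|triangles G|.
Proof.
have -> : triangles G = fst @: copies (complete 3) G.
  apply/setP => T; rewrite inE; apply/idP/imsetP => [trT|].
    have cT := triangle_card trT.
    pose f := [ffun i => enum_val (cast_ord (esym cT) i)].
    have injf : injective f.
      by move=> i j; rewrite !ffunE => /enum_val_inj /cast_ord_inj.
    have imf : f @: setT = T.
      apply/eqP; rewrite eqEcard card_imset // cardsT card_ord cT leqnn andbT.
      by apply/subsetP => _ /imsetP [i _ ->]; rewrite ffunE enum_valP.
    exists (f @: setT, [set f @: (e : {set 'I_3}) | e in edges (complete 3)]); last by [].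
    apply: imset_f; apply/embeddingP; split=> // i j; rewrite adj_complete => ij.
    by apply: triangle_adj trT _ _ _; rewrite ?(inj_eq injf) // -imf imset_f.
  move=> [c /imsetP [f /embeddingP [injf hf] ->] ->] /=.
  rewrite /triangle card_imset // cardsT card_ord eqxx /=.
  apply/forall_inP => _ /imsetP [i _ ->]; apply/forall_inP => _ /imsetP [j _ ->].
  by apply/implyP; rewrite (inj_eq injf) => ij; apply: hf; rewrite adj_complete.
rewrite card_in_imset // => _ _ /imsetP [f /embeddingP [injf _] ->]
  /imsetP [g /embeddingP [injg _] ->] /= eqfg; congr pair; first exact: eqfg.
have edgesE (h : {ffun 'I_3 -> V}) : injective h ->
    [set h @: (e : {set 'I_3}) | e in edges (complete 3)]
    = [set e : {set V} | (e \subset h @: setT) && (#|e| == 2)].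
  move=> injh; apply/setP => e; rewrite inE; apply/imsetP/andP.
    move=> [d]; rewrite inE => cd ->; split; last by rewrite card_imset.
    by rewrite imsetS // subsetT.
  move=> [/subsetP eh ce].
  have de : e = h @: (h @^-1: e).
    apply/setP => x; apply/idP/imsetP => [xe|[y]]; last by rewrite inE => ? ->.
    by have /imsetP [y _ dx] := eh x xe; exists y; rewrite ?inE -?dx.
  by exists (h @^-1: e); rewrite // inE -(card_imset _ injh) -de.
by rewrite !edgesE // eqfg.
Qed.

(** * Embedding extended friendship graphs *)

Section GreedyEmbedding.
Variables (V U : finType) (F : sgraph V) (G : sgraph U).
Implicit Types (S : {set V}) (f : V -> U) (x y z : V).

Definition partial_embedding S f :=
  {in S &, injective f} /\ {in S &, forall x y, adj F x y -> adj G (f x) (f y)}.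

Definition extend f x (u : U) y := if y == x then u else f y.

Lemma partial_embedding_extend S f x u :
  partial_embedding S f -> x \notin S -> u \notin f @: S ->
  {in S, forall z, adj F x z -> adj G u (f z)} ->
  partial_embedding (x |: S) (extend f x u).
Proof.
move=> [injf hf] xS uS hu.
have nx z : z \in S -> (z == x) = false by move=> zS; apply: contraNF xS => /eqP <-.
have nu z : z \in S -> f z <> u by move=> zS fz; rewrite -fz imset_f in uS.
rewrite /extend; split=> y z; rewrite !inE => /orP [/eqP ->|yS] /orP [/eqP ->|zS];
  rewrite ?eqxx ?nx //.
- by move/esym/nu; case.
- by move/nu; case.
- exact: injf.
- by rewrite adj_irrefl.
- exact: hu.
- by rewrite adj_sym [in X in _ -> X]adj_sym; apply: hu.
- exact: hf.
Qed.

Definition inside S : rel V := [rel x y | [&& x \in S, y \in S & adj F x y]].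

(* Holds when S meets every connected component of F in a connected set. *)
Definition locally_connected S :=
  {in S &, forall x y, connect (adj F) x y -> connect (inside S) x y}.

Lemma inside_sym S : symmetric (inside S).
Proof. by move=> x y; rewrite /inside /= adj_sym andbCA. Qed.

Lemma inside_path_sub S x p : path (inside S) x p -> {subset p <= S}.
Proof.
elim: p x => //= y p IH x /andP [/and3P [_ yS _] /IH sub] z.
by rewrite inE => /orP [/eqP ->|/sub].
Qed.

Hypothesis cycle3 : forall s : seq V, is_cycle F s -> size s = 3.

(** If [y] and [z] differed, a simple path between them inside [S] would close up through [x] to a
    cycle. Such a cycle is a triangle, and triangles lie in [S], but [x] does not. *)
Lemma outside_neighbour_unique S x y z :
  locally_connected S -> (forall T, triangle F T -> T \subset S) ->
  x \notin S -> y \in S -> z \in S -> adj F x y -> adj F x z -> y = z.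
Proof.
move=> connS triS xS yS zS xy xz; apply/eqP/negPn/negP => yz.
have yz_conn : connect (adj F) y z.
  by apply: (connect_trans (y := x)); apply: connect1; rewrite // adj_sym.
have /connectP [p0 pp0 lz] := connS _ _ yS zS yz_conn; case/shortenP: pp0 lz => p pp up _ lz.
have pS := inside_path_sub pp.
have adjp : path (adj F) y p by apply: sub_path pp => a b /and3P [].
have cyc : ucycle (adj F) [:: x, y & p].
  apply/andP; split; first by rewrite /= rcons_path xy adjp -lz adj_sym xz.
  rewrite cons_uniq up andbT inE negb_or (memPnC xS) //=.
  by apply: contra xS => /pS.
have p0' : 0 < size p by case: (p) lz yz => //= ->; rewrite eqxx.
have := cycle3 (conj _ cyc); rewrite /= => /(_ p0').
case: p lz adjp {pp up pS cyc p0'} => [|a [|b p]] //= za /andP [ya _] _.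
rewrite za in xz.
have /triS /subsetP sub : triangle F [set x; y; a].
  by apply/triangleP; exists x, y, a.
by case/negP: xS; apply: sub; rewrite !inE eqxx.
Qed.

Lemma locally_connected_extend S x y :
  locally_connected S -> y \in S -> adj F x y -> locally_connected (x |: S).
Proof.
move=> connS yS xy.
have sub a b : connect (inside S) a b -> connect (inside (x |: S)) a b.
  apply: connect_sub => {}a {}b /and3P [aS bS ab]; apply: connect1.
  by rewrite /inside /= !inE aS bS ab !orbT.
have symc := sym_connect_sym (inside_sym (x |: S)).
have xy' : connect (inside (x |: S)) x y.
  by apply: connect1; rewrite /inside /= !inE eqxx yS xy orbT.
have xb b : b \in S -> connect (adj F) x b -> connect (inside (x |: S)) x b.
  move=> bS xcb; apply: connect_trans xy' _; apply/sub/connS => //.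
  by apply: connect_trans xcb; apply: connect1; rewrite adj_sym.
move=> a b; rewrite !inE => /orP [/eqP ->|aS] /orP [/eqP ->|bS].
- by rewrite connect0.
- exact: xb.
- by rewrite symc (sym_connect_sym (adj_sym F)); apply: xb.
- by move=> ab; apply/sub/connS.
Qed.

(** Here [S] is a union of components, so the component of [x] misses it. *)
Lemma locally_connected_new S x :
  locally_connected S -> closed (adj F) (mem S) -> x \notin S ->
  locally_connected (x |: S).
Proof.
move=> connS clS xS.
have sub a b : connect (inside S) a b -> connect (inside (x |: S)) a b.
  apply: connect_sub => {}a {}b /and3P [aS bS ab]; apply: connect1.
  by rewrite /inside /= !inE aS bS ab !orbT.
have nx b : b \in S -> ~~ connect (adj F) x b.
  by move=> bS; apply: contra xS => /(closed_connect clS) /= ->.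
move=> a b; rewrite !inE => /orP [/eqP ->|aS] /orP [/eqP ->|bS].
- by rewrite connect0.
- by rewrite (negPf (nx _ bS)).
- by rewrite (sym_connect_sym (adj_sym F)) (negPf (nx _ aS)).
- by move=> ab; apply/sub/connS.
Qed.

Hypothesis min_degree : forall u, #|V| <= #|nbhd G u|.

(** The vertex [x] witnesses that [S] is not everything, so the image of [S] has fewer than [#|V|]
    elements and cannot contain a neighbourhood. *)
Lemma fresh_neighbour S f x u : x \notin S -> exists2 t, adj G u t & t \notin f @: S.
Proof.
move=> xS.
have : ~~ (nbhd G u \subset f @: S).
  apply/negP => /subset_leq_card; apply/negP; rewrite -ltnNge.
  apply: leq_trans (min_degree u); apply: leq_ltn_trans (leq_imset_card _ _) _.
  by rewrite -cardsT; apply: proper_card; apply/properP; split; [|exists x].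
by case/subsetPn => t; rewrite inE; exists t.
Qed.

(** Induction on the number of vertices outside [S]. A vertex adjacent to [S] has only one neighbour
    there, so any fresh neighbour of that image will do; if there is no such vertex, a new component
    is started at any fresh vertex. *)
Lemma embed_forest_extension S f :
  locally_connected S -> (forall T, triangle F T -> T \subset S) ->
  partial_embedding S f -> ~~ free F G.
Proof.
move: {2}#|~: S| (leqnn #|~: S|) => n.
elim: n S f => [|n IH] S f.
  rewrite leqn0 cards_eq0 => /eqP /(congr1 (fun A => ~: A)).
  rewrite setCK setC0 => -> _ _ [injf hf].
  by apply/freePn; exists f; split=> x y; [apply: injf|apply: hf]; rewrite inE.
move=> cS connS triS embS.
have step x u : x \notin S -> u \notin f @: S -> locally_connected (x |: S) ->
    {in S, forall z, adj F x z -> adj G u (f z)} -> ~~ free F G.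
  move=> xS uS connS' hu.
  apply: IH connS' _ (partial_embedding_extend embS xS uS hu).
    by move: cS; rewrite setCU setIC -setDE (cardsD1 x (~: S)) inE xS.
  by move=> T /triS TS; apply: subset_trans TS (subsetUr _ _).
have [/existsP [x /andP [xS /existsP [y /andP [yS xy]]]]|noadj] :=
  boolP [exists x, (x \notin S) && [exists y, (y \in S) && adj F x y]].
  have [t ut tS] := fresh_neighbour f (f y) xS.
  apply: (step x t) => //; first exact: locally_connected_extend yS xy.
  move=> z zS xz; rewrite -(outside_neighbour_unique connS triS xS yS zS xy xz).
  by rewrite adj_sym.
have nadj x y : x \notin S -> y \in S -> ~~ adj F x y.
  move=> xS yS; apply: contra noadj => xy.
  by apply/existsP; exists x; rewrite xS; apply/existsP; exists y; rewrite yS.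
have clS : closed (adj F) (mem S).
  move=> x y xy; rewrite /in_mem /=; apply/idP/idP => h; apply: contraLR xy => h'.
    by rewrite adj_sym nadj.
  by rewrite nadj.
have [eS|] := eqVneq S setT.
  case: embS => injf hf; apply/freePn.
  by exists f; split=> a b; [apply: injf|apply: hf]; rewrite eS inE.
rewrite -subTset => /subsetPn [x _ xS].
(* Only the freshness of [t] matters: [x] has no neighbour in [S]. *)
have [t _ tS] := fresh_neighbour f (f x) xS.
apply: (step x t) => //; first exact: locally_connected_new.
by move=> z zS xz; case/negP: (nadj _ _ xS zS).
Qed.

End GreedyEmbedding.

Section FriendshipEmbedding.
Variables (V U : finType) (F : sgraph V) (G : sgraph U) (v : V) (u : U).
Hypothesis centre : forall T, triangle F T -> v \in T.
Hypothesis meet_centre : forall T1 T2,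
  triangle F T1 -> triangle F T2 -> T1 != T2 -> T1 :&: T2 = [set v].

Lemma centre_unique T1 T2 x :
  triangle F T1 -> triangle F T2 -> T1 != T2 -> x \in T1 -> x \in T2 -> x = v.
Proof.
by move=> t1 t2 n12 x1 x2; apply/set1P; rewrite -(meet_centre t1 t2 n12) inE x1.
Qed.

Lemma locally_connected_triangles (Ts : {set {set V}}) :
  Ts \subset triangles F -> locally_connected F (v |: cover Ts).
Proof.
move=> subT.
have symc := sym_connect_sym (inside_sym F (v |: cover Ts)).
have toc x : x \in v |: cover Ts -> connect (inside F (v |: cover Ts)) v x.
  rewrite inE => /orP [/set1P ->|xT]; first exact: connect0.
  have [->|xv] := eqVneq x v; first exact: connect0.
  apply: connect1; rewrite /inside /= !inE eqxx xT orbT /=.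
  have /bigcupP [T TTs xinT] := xT.
  have := subsetP subT _ TTs; rewrite inE => trT.
  by apply: triangle_adj trT (centre trT) xinT _; rewrite eq_sym.
by move=> x y xS yS _; apply: connect_trans (toc _ yS); rewrite symc toc.
Qed.

Hypothesis rich : forall X : {set U}, #|X| <= #|V| ->
  exists y z, [/\ adj G u y, adj G u z, adj G y z, y \notin X & z \notin X].

Lemma embed_friendship (Ts : {set {set V}}) :
  Ts \subset triangles F ->
  exists2 f : V -> U, f v = u & partial_embedding F G (v |: cover Ts) f.
Proof.
move: {2}#|Ts| (leqnn #|Ts|) => n.
elim: n Ts => [|n IH] Ts cT subT.
  exists (fun=> u) => //; move: cT; rewrite leqn0 cards_eq0 => /eqP ->.
  rewrite /cover big_set0 setU0; split=> x y /set1P -> /set1P -> //.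
  by rewrite adj_irrefl.
have [Ts0|/set0Pn [T TTs]] := eqVneq Ts set0.
  by apply: IH => //; rewrite Ts0 cards0.
have trT : triangle F T by have := subsetP subT _ TTs; rewrite inE.
have subT' : Ts :\ T \subset triangles F by apply: subset_trans subT; rewrite subsetDl.
have [f fv embf] : exists2 f, f v = u & partial_embedding F G (v |: cover (Ts :\ T)) f.
  by apply: IH => //; move: cT; rewrite (cardsD1 T) TTs.
set S := v |: cover (Ts :\ T) in embf.
have [a [b [dT va vb ab]]] := triangle_at trT (centre trT).
have inS t : t \in S -> t != v ->
    exists2 T' : {set V}, t \in T' & [/\ triangle F T', T' != T & T' \subset S].
  rewrite !inE => /orP [->//|/bigcupP [T' T'Ts tT'] _]; exists T' => //.
  have := subsetP subT' _ T'Ts; rewrite inE => trT'.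
  split=> //; first by move: T'Ts; rewrite !inE => /andP [].
  by apply/subsetP => z zT'; rewrite !inE; apply/orP; right; apply/bigcupP; exists T'.
have outS c : c \in T -> c != v -> c \notin S.
  move=> cT' cv; apply/negP => /inS /(_ cv) [T' cT'' [trT' nT' _]].
  by move/eqP: cv; apply; apply: centre_unique trT' trT nT' cT'' cT'.
(* Otherwise [v], [c], [t] form a triangle which shares [v] and [t] with the embedded triangle [T']
   but differs from it by [c]. *)
have onlyv c t : c \in T -> c != v -> t \in S -> adj F c t -> t = v.
  move=> cinT cv tS ct; apply/eqP/negPn/negP => tv.
  have [T' tT' [trT' nT' T'S]] := inS _ tS tv.
  have tri : triangle F [set v; c; t].
    apply/triangleP; exists v, c, t; split=> //.
      by apply: triangle_adj trT (centre trT) cinT _; rewrite eq_sym.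
    by apply: triangle_adj trT' (centre trT') tT' _; rewrite eq_sym.
  case/eqP: tv; apply: centre_unique tri trT' _ _ tT'; last by rewrite !inE eqxx orbT.
  apply: contraNneq (outS _ cinT cv) => eT; apply: (subsetP T'S).
  by rewrite -eT !inE eqxx orbT.
have aT : a \in T by rewrite dT !inE eqxx orbT.
have bT : b \in T by rewrite dT !inE eqxx orbT.
have av : a != v by rewrite eq_sym (adj_neq va).
have bv : b != v by rewrite eq_sym (adj_neq vb).
have aS := outS _ aT av; have bS := outS _ bT bv.
have vS : v \in S by rewrite !inE eqxx.
have cX : #|f @: S| <= #|V| by apply: leq_trans (leq_imset_card _ _) (max_card _).
have [y [z [uy uz yz yX zX]]] := rich cX.
pose f1 := extend f a y.
have f1S t : t \in S -> f1 t = f t.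
  by rewrite /f1 /extend; case: eqP => // -> /(negP aS).
have f1a : f1 a = y by rewrite /f1 /extend eqxx.
have emb1 : partial_embedding F G (a |: S) f1.
  apply: partial_embedding_extend embf aS yX _ => t tS a_t.
  by rewrite (onlyv _ _ aT av tS a_t) fv adj_sym.
have emb2 : partial_embedding F G (b |: (a |: S)) (extend f1 b z).
  apply: partial_embedding_extend emb1 _ _ _.
  - by rewrite in_setU1 negb_or bS eq_sym (adj_neq ab).
  - apply/imsetP => [[t]]; rewrite in_setU1 => /orP [/eqP ->|tS] zt.
      by move: (adj_neq yz); rewrite zt f1a eqxx.
    by case/negP: zX; rewrite zt f1S // imset_f.
  - move=> t; rewrite in_setU1 => /orP [/eqP ->|tS] b_t; first by rewrite f1a adj_sym.
    by rewrite (onlyv _ _ bT bv tS b_t) f1S // fv adj_sym.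
exists (extend f1 b z).
  by rewrite /extend eq_sym (negPf bv) f1S.
have sub : v |: cover Ts \subset b |: (a |: S).
  apply/subsetP => t; rewrite in_setU1 => /orP [/eqP ->|/bigcupP [T' T'Ts tT']].
    by rewrite 2!in_setU1 vS !orbT.
  have [eT|nT] := eqVneq T' T.
    by move: tT'; rewrite eT dT !inE => /orP [/orP [] |] ->; rewrite ?orbT.
  rewrite !in_setU1; apply/orP; right; apply/orP; right; apply/orP; right.
  by apply/bigcupP; exists T'; rewrite // !inE nT.
case: emb2 => inj2 hom2; split=> s t /(subsetP sub) sS /(subsetP sub) tS.
  exact: inj2.
exact: hom2.
Qed.
End FriendshipEmbedding.

(** * The linear upper bound *)

(** With a single triangle the vertex given by the definition is arbitrary and may miss it, so a
    vertex of that triangle is taken instead. *)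
Lemma extended_friendship_centre (V : finType) (F : sgraph V) (T0 : {set V}) :
  extended_friendship F -> triangle F T0 ->
  exists v, (forall T, triangle F T -> v \in T) /\
    forall T1 T2, triangle F T1 -> triangle F T2 -> T1 != T2 -> T1 :&: T2 = [set v].
Proof.
move=> [_ centre] tr0.
have [/existsP [T1 /andP [tr1 n1]]|only] :=
  boolP [exists T1, triangle F T1 && (T1 != T0)].
  case: centre => [V0|[v meet]].
    by have := max_card (mem T0); rewrite (triangle_card tr0) V0.
  have v0 T : triangle F T -> T != T0 -> (v \in T) && (v \in T0).
    by move=> tr n; rewrite -in_setI (meet _ _ tr tr0 n) set11.
  exists v; split=> // T tr; have [->|n] := eqVneq T T0.
    by case/andP: (v0 _ tr1 n1).
  by case/andP: (v0 _ tr n).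
have all0 T : triangle F T -> T = T0.
  move=> tr; apply/eqP; apply: contraNT only => n.
  by apply/existsP; exists T; rewrite tr.
have /card_gt0P [v vT0] : 0 < #|T0| by rewrite (triangle_card tr0).
exists v; split=> [T /all0 -> //|T1 T2 /all0 -> /all0 ->].
by rewrite eqxx.
Qed.

(** A small neighbourhood covers itself. Otherwise regularity makes all degrees large, and without a
    cover [F] would embed with its centre at [u]. The boolean form lets [xchoose] select the
    covers. *)
Lemma extended_friendship_link_cover (V U : finType) (F : sgraph V) (G : sgraph U) :
  extended_friendship F -> free F G -> regular G ->
  forall u : U, exists X : {set U}, (#|X| <= #|V|) &&
    [forall y, forall z,
      [&& adj G u y, adj G u z & adj G y z] ==> (y \in X) || (z \in X)].
Proof.
move=> extF freeG regG u.
have [degu|degu] := leqP #|nbhd G u| #|V|.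
  exists (nbhd G u); rewrite degu; apply/forallP => y; apply/forallP => z.
  by apply/implyP => /and3P [uy _ _]; rewrite inE uy.
have mindeg w : #|V| <= #|nbhd G w|.
  by move/forallP: regG => /(_ u) /forallP /(_ w); rewrite !degreeE => /eqP <-; apply: ltnW.
have cyc3 : forall s, is_cycle F s -> size s = 3 by case: extF.
(* Without triangles [F] is a forest and embeds greedily from the empty set. *)
have [/existsP [T0 tr0]|notri] := boolP [exists T, triangle F T]; last first.
  suff : ~~ free F G by rewrite freeG.
  apply: (@embed_forest_extension _ _ _ _ cyc3 mindeg set0 (fun=> u)).
  - by move=> x y; rewrite inE.
  - by move=> T tr; case/existsP: notri; exists T.
  - by split=> x y; rewrite inE.
have [v [centre meet]] := extended_friendship_centre extF tr0.
apply/existsP; apply: contraT => /existsPn poor.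
have rich' (X : {set U}) : #|X| <= #|V| ->
  exists y z, [/\ adj G u y, adj G u z, adj G y z, y \notin X & z \notin X].
  move=> cX; have := poor X; rewrite cX => /forallPn [y /forallPn [z]].
  by rewrite negb_imply negb_or => /andP [/and3P [uy uz yz] /andP [yX zX]]; exists y, z.
have [f _ embf] := embed_friendship centre meet rich' (subxx (triangles F)).
suff : ~~ free F G by rewrite freeG.
apply: (embed_forest_extension cyc3 mindeg _ _ embf).
  exact: locally_connected_triangles.
move=> T tr; apply/subsetP => x xT; rewrite in_setU1; apply/orP; right.
by apply/bigcupP; exists T; rewrite // inE.
Qed.

Lemma rex_extended_friendship (V : finType) (F : sgraph V) (n : nat) :
  extended_friendship F -> rex n (complete 3) F <= 2 * #|V| * #|V| * n.
Proof.
move=> extF; apply/bigmax_leqP => G /andP [freeG regG].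
rewrite ncopies_K3 -[X in _ * X]card_ord.
have cov := extended_friendship_link_cover extF freeG regG.
apply: (@triangles_link_cover _ _ _ (fun u => xchoose (cov u))) => [u|u y z uy uz yz].
  by case/andP: (xchooseP (cov u)).
case/andP: (xchooseP (cov u)) => _ /forallP /(_ y) /forallP /(_ z).
by rewrite uy uz yz.
Qed.

(** * Triangles through a common vertex *)

Section GraphOfRelation.
Variables (V : finType) (e : rel V).

Lemma graph_of_card2 :
  [forall A in [set A : {set V} | (#|A| == 2) &&
     [forall x in A, forall y in A, (x != y) ==> e x y]], #|A| == 2].
Proof. by apply/forall_inP => A; rewrite inE => /andP []. Qed.

Definition graph_of : sgraph V := SGraph graph_of_card2.

Hypotheses (sym_e : symmetric e) (irr_e : irreflexive e).

Lemma adj_graph_of x y : adj graph_of x y = e x y.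
Proof.
rewrite /adj /= inE cards2; have [<-|xy] := eqVneq x y; first by rewrite irr_e.
apply/forall_inP/idP => [h|exy a].
  have /forall_inP /(_ y) := h x ltac:(by rewrite !inE eqxx).
  by rewrite !inE eqxx orbT xy => /(_ isT).
rewrite !inE => aE; apply/forall_inP => b; rewrite !inE => bE; apply/implyP.
by case/orP: aE bE => /eqP -> /orP [] /eqP ->; rewrite ?eqxx // sym_e.
Qed.
End GraphOfRelation.

(** Since [rex] ranges over graphs on ordinals, [G] is transported along [enum_rank]. *)
Lemma leq_rex (V U : finType) (F : sgraph U) (G : sgraph V) :
  free F G -> regular G -> #|triangles G| <= rex #|V| (complete 3) F.
Proof.
move=> freeG regG.
pose e := [rel i j : 'I_#|V| | adj G (enum_val i) (enum_val j)].
have adjE : adj (graph_of e) =2 e.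
  by apply: adj_graph_of => [i j|i] /=; [apply: adj_sym|apply: adj_irrefl].
have freeG' : free F (graph_of e).
  apply: contraTT freeG => /freePn [f [injf hf]]; apply/freePn.
  exists (enum_val \o f); split; first exact: inj_comp enum_val_inj injf.
  by move=> x y /hf; rewrite adjE.
have regG' : regular (graph_of e).
  have degE i : degree (graph_of e) i = degree G (enum_val i).
    rewrite !degreeE -[RHS](card_imset _ enum_rank_inj); apply: eq_card => j.
    rewrite inE adjE /=; apply/idP/imsetP => [ij|[x]].
      by exists (enum_val j); rewrite ?inE ?enum_valK.
    by rewrite inE => ix ->; rewrite enum_rankK.
  apply/forallP => i; apply/forallP => j; rewrite !degE.
  by move/forallP: regG => /(_ (enum_val i)) /forallP.
apply: (bigmax_sup (graph_of e)); first by rewrite freeG' regG'.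
rewrite ncopies_K3.
rewrite -(card_imset _ (imset_inj (@enum_rank_inj V))).
apply/subset_leq_card/subsetP => _ /imsetP [T /[!inE] /triangleP [x [y [z [-> xy xz yz]]]] ->].
apply/triangleP; exists (enum_rank x), (enum_rank y), (enum_rank z).
by rewrite !adjE /= !enum_rankK !imsetU !imset_set1.
Qed.

Section CommonVertexGraph.
Variable m : nat.
Let V := option (bool * ('I_m * bool)).

(* K_{2m,2m} with a matching of size m deleted (the edges between the vertices
   (s, (i, true)) and (~~ s, (i, true))) and a new vertex None joined to all
   the ends of the deleted edges: this is 2m-regular, and all its triangles
   contain None because the rest is bipartite. *)
Definition cv_rel : rel V := fun x y =>
  match x, y with
  | None, None => false
  | None, Some (_, (_, c)) => c
  | Some (_, (_, c)), None => c
  | Some (s, (i, c)), Some (t, (j, c')) => (s != t) && ~~ [&& c, c' & i == j]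
  end.

Definition cv_graph := graph_of cv_rel.

Lemma adj_cv x y : adj cv_graph x y = cv_rel x y.
Proof.
apply: adj_graph_of => [[[s [i c]]|] [[t [j c']]|] | [[s [i c]]|]] //=.
  by rewrite eq_sym (eq_sym i); case: c; case: c'.
by rewrite eqxx.
Qed.

Lemma cv_degree x : #|nbhd cv_graph x| = m * 2.
Proof.
have card2m : #|{: 'I_m * bool}| = m * 2 by rewrite card_prod card_ord card_bool.
case: x => [[s [i c]]|].
  (* Neighbours are indexed by the opposite side, with [None] replacing the end of a deleted
     matching edge. *)
  pose h (p : 'I_m * bool) : V :=
    if [&& c, p.2 & p.1 == i] then None else Some (~~ s, p).
  have injh : injective h.
    move=> [j a] [j' a']; rewrite /h /=.
    case: ifP => [/and3P [_ a1 /eqP ->]|h1]; case: ifP => [/and3P [_ a2 /eqP ->]|h2] //.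
      by move=> _; congr pair; case: a a' a1 a2 => [] [].
    by case=> -> ->.
  rewrite -card2m -cardsT -(card_imset _ injh); apply: eq_card => y; rewrite inE adj_cv.
  apply/idP/imsetP => [|[[j a] _ ->]].
    case: y => [[t [j a]]|] /= => [/andP [st nm]|c1].
      exists (j, a); rewrite // /h /= (eq_sym j) (negPf nm).
      by case: (s) (t) st => [] [].
    by exists (i, true); rewrite // /h /= c1 eqxx.
  rewrite /h /=; case: ifP => [/and3P []//|/negbT nm] /=.
  by rewrite (eq_sym i) nm andbT; case: (s).
pose h (p : 'I_m * bool) : V := Some (p.2, (p.1, true)).
have injh : injective h by move=> [j a] [j' a'] [-> ->].
rewrite -card2m -cardsT -(card_imset _ injh); apply: eq_card => y; rewrite inE adj_cv.
apply/idP/imsetP => [|[[j a] _ ->]] //.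
by case: y => [[t [j []]]|] //= _; exists (j, t).
Qed.

Lemma cv_regular : regular cv_graph.
Proof.
by apply/forallP => x; apply/forallP => y; rewrite !degreeE !cv_degree.
Qed.

Lemma cv_triangle T : triangle cv_graph T -> None \in T.
Proof.
case/triangleP => [x [y [z [-> ]]]]; rewrite !adj_cv !inE.
case: x y z => [[s [i c]]|] [[t [j c']]|] [[r [l c'']]|] //=.
by case: s t r => [] [] [].
Qed.

(** Each ordered pair of distinct indices gives a non-deleted edge between ends of deleted ones,
    hence a triangle with [None]. *)
Lemma cv_triangles : m * m <= #|triangles cv_graph| + m.
Proof.
pose P := [set p : 'I_m * 'I_m | p.1 != p.2].
pose D := [set (i, i) | i : 'I_m].
have PD : [set: 'I_m * 'I_m] = P :|: D.
  apply/setP => [[i j]]; rewrite !inE /=; have [->|//] := eqVneq i j.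
  by rewrite imset_f.
have -> : m * m = #|P :|: D| by rewrite -PD cardsT card_prod card_ord.
apply: leq_trans (leq_card_setU _ _) _; rewrite leq_add //; last first.
  by apply: leq_trans (leq_imset_card _ _) _; rewrite card_ord.
pose h (p : 'I_m * 'I_m) : {set V} :=
  [set None; Some (true, (p.1, true)); Some (false, (p.2, true))].
have injh : injective h.
  move=> [i j] [i' j'] /= eqh.
  have := set21 (None : V) (Some (true, (i, true))).
  have hi : Some (true, (i, true)) \in h (i', j') by rewrite -eqh !inE eqxx.
  have hj : Some (false, (j, true)) \in h (i', j') by rewrite -eqh !inE eqxx orbT.
  move: hi hj; rewrite !inE => /orP [/orP [//|/eqP [->]]|/eqP //].
  by case/orP => [/orP [//|/eqP //]|/eqP [->]].
rewrite -(card_imset _ injh); apply/subset_leq_card/subsetP => _ /imsetP [[i j] /[!inE] ij ->].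
apply/triangleP; exists None, (Some (true, (i, true))), (Some (false, (j, true))).
by rewrite !adj_cv /= ij.
Qed.
End CommonVertexGraph.

Lemma disjoint_triangles_superlinear (V : finType) (F : sgraph V) (T1 T2 : {set V}) :
  triangle F T1 -> triangle F T2 -> [disjoint T1 & T2] ->
  ~ is_O_id (fun n => rex n (complete 3) F).
Proof.
move=> tr1 tr2 dis [C [N rexO]].
(* The graph has [4 * m + 1] vertices: [N] puts this past the threshold, and [5 * C] makes
   [m * m - m] exceed [C * (4 * m + 1)]. *)
pose m := 5 * C + N + 2.
have freeF : free F (cv_graph m).
  apply/negPn/negP => /freePn [f [injf hf]].
  have triF T : triangle F T -> None \in f @: T.
    move=> tr; apply: cv_triangle; case/triangleP: tr => [x [y [z [-> xy xz yz]]]].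
    apply/triangleP; exists (f x), (f y), (f z).
    by rewrite !imsetU !imset_set1; split; auto.
  have /imsetP [x x1 fx] := triF _ tr1; have /imsetP [y y2 fy] := triF _ tr2.
  have xy : x = y by apply: injf; rewrite -fx.
  by move: (disjointFr dis x1); rewrite xy y2.
have := leq_trans (leq_rex freeF (cv_regular m)) (rexO _ _).
rewrite card_option !card_prod card_ord card_bool.
have := cv_triangles m; rewrite /m; nia.
Qed.

(** * Cayley graphs with no cycles of length 4 to k *)

Section Words.
Variables (I : finType) (k : nat).

(** The pair [(i, f)] is the [f]-th power of the generator [i]. Words carry their last factor at the
    head, where right multiplication acts. *)
Definition syllable := (I * 'Z_3)%type.
Implicit Types (w r : seq syllable) (i j : I) (f g : 'Z_3).

Definition heads i w := if w is s :: _ then s.1 == i else false.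
(** A reduced word splits into a power of [i], with exponent 0 if another generator is at the head,
    and a remainder not starting with [i]. *)
Definition head_exp i w : 'Z_3 :=
  if w is s :: _ then if s.1 == i then s.2 else 0%R else 0%R.
Definition strip i w :=
  if w is s :: w' then if s.1 == i then w' else w else [::].
Definition put i f w := if f == 0%R then w else (i, f) :: w.

(* Words spell the elements of the free product of copies of Z/3 indexed by I. *)
Fixpoint reduced w :=
  if w is s :: w' then [&& s.2 != 0%R, ~~ heads s.1 w' & reduced w'] else true.

(* Multiplication by the f-th power of the i-th generator on the ball of radius
   k, where a word stays put if its orbit would leave the ball. *)
Definition shift i f w :=
  if size (strip i w) < k then put i (f + head_exp i w)%R (strip i w) else w.

Lemma strip_heads i w : reduced w -> ~~ heads i (strip i w).
Proof.
case: w => //= s w /and3P [_ hs _]; have [<-//|] := eqVneq s.1 i.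
by move=> /= /negPf ->.
Qed.

Lemma reduced_strip i w : reduced w -> reduced (strip i w).
Proof. by case: w => //= s w; case: ifP => //= _ /and3P []. Qed.

Lemma head_exp_put i f r : ~~ heads i r -> head_exp i (put i f r) = f.
Proof.
rewrite /put; case: eqP => [->|_ _] /=; last by rewrite eqxx.
by case: r => //= s r /negPf ->.
Qed.

Lemma strip_put i f r : ~~ heads i r -> strip i (put i f r) = r.
Proof.
rewrite /put; case: eqP => [_|_ _] /=; last by rewrite eqxx.
by case: r => //= s r /negPf ->.
Qed.

Lemma put_strip i w : reduced w -> put i (head_exp i w) (strip i w) = w.
Proof.
rewrite /put; case: w => //= [[j f] w] /= /and3P [f0 _ _].
by have [->|_] := eqVneq j i; rewrite ?eqxx // (negPf f0).
Qed.

Lemma reduced_shift i f w : reduced w -> reduced (shift i f w).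
Proof.
move=> rw; rewrite /shift; case: ifP => // _; rewrite /put.
by case: ifPn => [|f0] /=; rewrite ?reduced_strip // f0 strip_heads.
Qed.

Lemma size_shift i f w : size w <= k -> size (shift i f w) <= k.
Proof.
rewrite /shift; case: ifP => // lt _; rewrite /put.
by case: ifP => //= _; apply: ltnW.
Qed.

Lemma shift0 i w : reduced w -> shift i 0%R w = w.
Proof. by move=> rw; rewrite /shift GRing.add0r put_strip // if_same. Qed.

(** The size test sees only [strip i w], which is constant on the orbit, so both shifts take the
    same branch and the exponents add. *)
Lemma shiftD i f g w : reduced w -> shift i f (shift i g w) = shift i (f + g)%R w.
Proof.
move=> rw; have hr := strip_heads i rw; rewrite {2 3}/shift; case: ifP => lt.
  by rewrite /shift strip_put // head_exp_put // lt GRing.addrA.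
by rewrite /shift lt.
Qed.

Lemma shift_push i f w :
  f != 0%R -> ~~ heads i w -> size w < k -> shift i f w = (i, f) :: w.
Proof.
move=> f0 hw lt; have sw : strip i w = w by case: w hw {lt} => //= s w /negPf ->.
have ew : head_exp i w = 0%R by case: w hw {lt sw} => //= s w /negPf ->.
by rewrite /shift sw ew lt GRing.addr0 /put (negPf f0).
Qed.

Definition ball := {w : k.-bseq syllable | reduced w}.

Definition ball_root : ball := exist _ (Bseq (isT : size [::] <= k)) isT.

Definition rot_fun i f (w : ball) : ball :=
  exist _ (Bseq (size_shift i f (size_bseq (val w)))) (reduced_shift i f (valP w)).

Definition word (w : ball) : seq syllable := val w.

Lemma word_inj : injective word.
Proof. exact: inj_comp val_inj val_inj. Qed.

Lemma rot_inj i f : injective (rot_fun i f).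
Proof.
apply: (can_inj (g := rot_fun i (- f)%R)) => w; apply: word_inj.
by rewrite /word /= shiftD ?(valP w) // GRing.addNr shift0 ?(valP w).
Qed.

Definition rot i f : {perm ball} := perm (@rot_inj i f).

Local Open Scope group_scope.

Lemma rotD i f g : rot i f * rot i g = rot i (f + g)%R.
Proof.
apply/permP => w; rewrite permM !permE; apply: word_inj.
by rewrite /word /= shiftD ?(valP w) // GRing.addrC.
Qed.

Lemma rot0 i : rot i 0%R = 1.
Proof.
by apply/permP => w; rewrite !permE; apply: word_inj; rewrite /word /= shift0 ?(valP w).
Qed.

(** The image of the empty word; a nonempty spelling certifies that [x] is not the identity. *)
Definition spelling (x : {perm ball}) := word (x ball_root).

Lemma spelling1 : spelling 1 = [::].
Proof. by rewrite /spelling perm1. Qed.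

Lemma spelling_rot x i f :
  spelling (x * rot i f) = shift i f (spelling x).
Proof. by rewrite /spelling permM permE. Qed.

Lemma spelling_push x i f : f != 0%R -> ~~ heads i (spelling x) ->
  size (spelling x) < k -> spelling (x * rot i f) = (i, f) :: spelling x.
Proof. by move=> *; rewrite spelling_rot shift_push. Qed.

Hypothesis k0 : 0 < k.

(** A nontrivial [rot i f] sends the empty word to the single syllable [(i, f)], from which both
    indices are read off. *)
Lemma rot_eq i j f g : f != 0%R -> rot i f = rot j g -> (i, f) = (j, g).
Proof.
move=> f0 eqr; have g0 : g != 0%R.
  apply: contraNneq f0 => g0; move: eqr; rewrite g0 rot0 => eqr.
  have := @spelling_push 1 i f; rewrite mul1g eqr spelling1 /=.
  by case: (f =P 0%R) => // f0 /(_ isT isT k0).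
have s i' f' : f' != 0%R -> spelling (rot i' f') = [:: (i', f')].
  by move=> f0'; rewrite -[rot _ _]mul1g spelling_push // spelling1.
by have := s i f f0; rewrite eqr s // => -[-> ->].
Qed.

(** Built on all permutations of the ball, this is a disjoint union of copies of the Cayley graph of
    the subgroup that the rotations generate. *)
Definition cay_rel : rel {perm ball} :=
  [rel x y | [exists s : syllable, (s.2 != 0%R) && (y == x * rot s.1 s.2)]].

Definition cay := graph_of cay_rel.

Lemma cay_relP x y :
  reflect (exists i f, f != 0%R /\ y = x * rot i f) (cay_rel x y).
Proof.
apply: (iffP existsP) => [[[i f] /= /andP [f0 /eqP ->]]|[i [f [f0 ->]]]].
  by exists i, f.
by exists (i, f); rewrite /= f0 eqxx.
Qed.

Lemma adj_cay x y : adj cay x y = cay_rel x y.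
Proof.
apply: adj_graph_of => {x y} [x y|x].
  suff sub a b : cay_rel a b -> cay_rel b a by apply/idP/idP; apply: sub.
  case/cay_relP => [i [f [f0 ->]]]; apply/cay_relP; exists i, (- f)%R.
  by rewrite GRing.oppr_eq0 -mulgA rotD GRing.addrN rot0 mulg1.
apply/cay_relP => [[i [f [f0 /(canLR (mulKg x))]]]].
rewrite mulVg -(rot0 i) => /esym/rot_eq -/(_ f0) [f0'].
by rewrite f0' eqxx in f0.
Qed.

Lemma cay_regular : regular cay.
Proof.
have deg x : degree cay x = #|[set s : syllable | s.2 != 0%R]|.
  rewrite degreeE -(card_in_imset (f := fun s : syllable => x * rot s.1 s.2)).
    apply: eq_card => y; rewrite inE adj_cay; apply/cay_relP/imsetP.
      by move=> [i [f [f0 ->]]]; exists (i, f); rewrite ?inE.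
    by move=> [[i f] /[!inE] f0 ->]; exists i, f.
  by move=> [i f] [j g] /[!inE] /= f0 _ /mulgI/rot_eq -/(_ f0).
by apply/forallP => x; apply/forallP => y; rewrite !deg.
Qed.

Lemma card_cay : #|I| <= #|{perm ball}|.
Proof.
apply: (leq_card (fun i => rot i 1%R)) => i j /rot_eq -/(_ isT) [] //.
Qed.

(** Double counting of flags: each pair [(x, i)] gives [x] inside its coset of the powers of the
    generator [i], distinct pairs give distinct flags, and a triangle has only three. *)
Lemma cay_triangles : #|{perm ball}| * #|I| <= 3 * #|triangles cay|.
Proof.
pose T x i : {set {perm ball}} := [set x * rot i f | f : 'Z_3].
have trT x i : triangle cay (T x i).
  have injT : injective (fun f => x * rot i f).
    move=> f g /mulgI eqfg; have [f0|/rot_eq -/(_ _ _ _ eqfg) [//]] := eqVneq f 0%R.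
    have [->//|/rot_eq -/(_ _ _ _ (esym eqfg)) [//]] := eqVneq g 0%R.
  rewrite /triangle card_imset // card_ord eqxx /=.
  apply/forall_inP => _ /imsetP [f _ ->]; apply/forall_inP => _ /imsetP [g _ ->].
  apply/implyP; rewrite (inj_eq injT) => fg; rewrite adj_cay; apply/cay_relP.
  exists i, (g - f)%R; rewrite GRing.subr_eq0 eq_sym fg -mulgA rotD.
  by rewrite GRing.addrC GRing.subrK.
pose D := \bigcup_(A in triangles cay) [set (x, A) | x in A].
have cD : #|D| <= 3 * #|triangles cay|.
  apply: leq_trans (card_bigcup_leq _ _) _; rewrite mulnC -sum_nat_const.
  apply: leq_sum => A /[!inE] trA; apply: leq_trans (leq_imset_card _ _) _.
  by rewrite (triangle_card trA).
apply: leq_trans cD; rewrite -card_prod -cardsT.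
have xT x i : x \in T x i by apply/imsetP; exists 0%R; rewrite // rot0 mulg1.
rewrite -(card_imset (f := fun p : {perm ball} * I => (p.1, T p.1 p.2))).
  apply/subset_leq_card/subsetP => _ /imsetP [[x i] _ ->] /=.
  by apply/bigcupP; exists (T x i); rewrite ?inE //; apply/imsetP; exists x.
move=> [x i] [y j] /= [<- eT]; congr pair.
have : x * rot i 1%R \in T x j by rewrite -eT; apply: imset_f.
by case/imsetP => g _ /mulgI/rot_eq -/(_ isT) [].
Qed.

(* The invariant along a simple path starting at x0, read in the tree of words:
   the last vertex lies in a triangle {x * rot i f} whose base x, the vertex
   nearest to x0, has been visited. As x is not visited again, the path can
   leave this triangle only away from x0. *)
Lemma cay_simple_path x0 p :
  0 < size p <= k -> path cay_rel x0 p -> uniq (x0 :: p) ->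
  let sp z := spelling (x0^-1 * z) in
  exists x i f, [/\ x \in x0 :: p, last x0 p = x * rot i f, f != 0%R,
    sp (last x0 p) = (i, f) :: sp x /\ ~~ heads i (sp x) /\ size (sp x) < size p
  & x = x0 -> {subset x0 :: p <= [set x0 * rot i g | g : 'Z_3]}].
Proof.
move=> szp pp up sp; have sp0 : sp x0 = [::] by rewrite /sp mulVg spelling1.
elim/last_ind: p szp pp up => // p y IH.
rewrite size_rcons rcons_path last_rcons -rcons_cons rcons_uniq => /= szp.
move=> /andP [pp /cay_relP [j [g [g0 yE]]]] /andP [ynew up].
have spD z i f : sp (z * rot i f) = shift i f (sp z).
  by rewrite /sp mulgA spelling_rot.
have sub_rcons z : z \in x0 :: p -> z \in rcons (x0 :: p) y.
  by rewrite mem_rcons in_cons orbC => ->.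
have [p0|pn0] := posnP (size p).
  move: yE; rewrite (size0nil p0) /= => yE; exists x0, j, g; split=> //.
  - by rewrite mem_head.
  - by rewrite yE spD sp0 shift_push.
  - move=> _ z; rewrite !inE => /orP [] /eqP ->; last by rewrite yE; apply: imset_f.
    by apply/imsetP; exists 0%R; rewrite // rot0 mulg1.
have [|x [i [f [xp lE f0 [spl [hx szx]] tri]]]] := IH _ pp up.
  by rewrite pn0 ltnW.
have xy : y != x by apply: contraNneq ynew => ->.
have szk : size p < k by [].
(* With the same generator the path stays in the current triangle, and [f + g] is nonzero because
   the base [x] is not revisited. Another generator opens a new triangle based at the last
   vertex. *)
have [eij|nij] := eqVneq j i.
  move: yE; rewrite eij lE -mulgA rotD => yE.
  have fg0 : (f + g)%R != 0%R.
    by apply: contraNneq xy => fg0; rewrite yE fg0 rot0 mulg1.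
  exists x, i, (f + g)%R; split=> //.
  - exact: sub_rcons.
  - rewrite yE spD shift_push //; last exact: ltn_trans szx szk.
    by split=> //; split=> //; apply: ltnW.
  - move=> x0E z; rewrite -rcons_cons mem_rcons in_cons => /orP [/eqP ->|]; last exact: tri.
    by rewrite yE x0E; apply: imset_f.
exists (last x0 p), j, g; split=> //.
- by apply: sub_rcons; rewrite mem_last.
- by rewrite yE spD spl shift_push //= 1?eq_sym //; apply: leq_ltn_trans szx szk.
(* The new base has a nonempty spelling, so it is not [x0]. *)
- by move=> lx0; move: spl; rewrite lx0 sp0.
Qed.

(** If the last triangle is based at [x0], the whole cycle lies in its three vertices. Otherwise the
    closing edge would have to return to the empty word, but it leaves a syllable at the head. *)
Lemma cay_no_long_cycle (s : seq {perm ball}) :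
  3 < size s <= k -> ucycle (adj cay) s -> False.
Proof.
case: s => // x0 p /= szp; rewrite /ucycle /= rcons_path.
rewrite (eq_path adj_cay) adj_cay => /andP [/andP [pp /cay_relP [j [g [g0 x0E]]]] up].
have [|x [i [f [xp lE f0 [spl [hx szx]] tri]]]] := cay_simple_path _ pp up.
  by lia.
have notri : x <> x0.
  move=> x0x; have sub : {subset x0 :: p <= enum [set x0 * rot i g | g : 'Z_3]}.
    by move=> z /(tri x0x); rewrite mem_enum.
  have := uniq_leq_size (up : uniq (x0 :: p)) sub.
  rewrite -cardE => sz; have := leq_trans sz (leq_imset_card _ _).
  by rewrite card_ord => sz3; move: szp; rewrite ltnNge sz3.
have sp0 : spelling (x0^-1 * x0) = [::] by rewrite mulVg spelling1.
have szk : size p < k by lia.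
have [eij|nij] := eqVneq j i.
  move: x0E; rewrite eij lE -mulgA rotD => x0E.
  have fg0 : (f + g)%R != 0%R.
    by apply: contra_not_neq notri => fg0; rewrite x0E fg0 rot0 mulg1.
  move: sp0; rewrite [X in _ * X]x0E mulgA spelling_push //.
  exact: ltn_trans szx szk.
move: sp0; rewrite [X in _ * X]x0E mulgA spelling_push // spl /= 1?eq_sym //.
exact: leq_ltn_trans szx szk.
Qed.
End Words.

Lemma long_cycle_superlinear (V : finType) (F : sgraph V) (s : seq V) :
  is_cycle F s -> size s != 3 -> ~ is_O_id (fun n => rex n (complete 3) F).
Proof.
move=> [szs /andP [cyc us]] s3 [C [N rexO]].
(* There are at least [d] vertices, hence at least [N], and [d / 3] triangles per vertex, which
   exceeds [C]. *)
pose d := 3 * C + N + 1; pose k := size s.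
have k0 : 0 < k by rewrite /k; lia.
have freeF : free F (cay 'I_d k).
  apply/negPn/negP => /freePn [f [injf hf]].
  apply: (@cay_no_long_cycle 'I_d k k0 (map f s)).
    by rewrite size_map leqnn; lia.
  rewrite /ucycle map_inj_uniq // us andbT; apply: (homo_cycle hf) => //.
have := leq_trans (leq_rex freeF (cay_regular 'I_d k0)) (rexO _ _).
have := cay_triangles 'I_d k0; have := card_cay 'I_d k0; rewrite card_ord.
move: #|{perm _}| #|triangles _| => n t dn tn tC.
have tCn : t <= C * n by apply: tC; lia.
have : n * d <= n * (3 * C) by lia.
by rewrite leq_pmul2l; lia.
Qed.

(** * Linear growth forces an extended friendship graph *)

Lemma linear_rex_extended_friendship (V : finType) (F : sgraph V) :
  is_O_id (fun n => rex n (complete 3) F) -> extended_friendship F.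
Proof.
move=> rexO.
have cyc3 s : is_cycle F s -> size s = 3.
  by move=> cyc; apply/eqP/negPn/negP => /(long_cycle_superlinear cyc).
split=> //.
(* Disjoint triangles are excluded by the common-vertex graph; two shared vertices [x], [y] and the
   private ones [a], [b] would form the 4-cycle [a x b y]. *)
have one T1 T2 : triangle F T1 -> triangle F T2 -> T1 != T2 ->
    exists v, T1 :&: T2 = [set v].
  move=> tr1 tr2 n12; apply/cards1P; rewrite eqn_leq andbC; apply/andP; split.
    rewrite lt0n cards_eq0 setI_eq0; apply/negP => dis.
    exact: disjoint_triangles_superlinear tr1 tr2 dis rexO.
  rewrite leqNgt; apply/negP => /card_gt1P [x [y [/setIP [x1 x2] /setIP [y1 y2] xy]]].
  have [a a1 a2] : exists2 a, a \in T1 & a \notin T2.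
    apply/subsetPn; apply: contra n12 => sub.
    by rewrite eqEcard sub (triangle_card tr1) (triangle_card tr2).
  have [b b2 b1] : exists2 b, b \in T2 & b \notin T1.
    apply/subsetPn; apply: contra n12 => sub.
    by rewrite eq_sym eqEcard sub (triangle_card tr1) (triangle_card tr2).
  have nax z : z \in T2 -> a != z by move=> z2; apply: contraNneq a2 => ->.
  have nbx z : z \in T1 -> z != b by move=> z1; apply: contraNneq b1 => <-.
  have /cyc3 // : is_cycle F [:: a; x; b; y].
  split=> //; apply/andP; split.
    rewrite /= (triangle_adj tr1 a1 x1) ?nax // (triangle_adj tr2 x2 b2) ?nbx //.
    by rewrite (triangle_adj tr2 b2 y2) 1?eq_sym ?nbx // (triangle_adj tr1 y1 a1) // eq_sym nax.
  by rewrite /= !inE !negb_or !nax // nbx // xy eq_sym nbx.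
have [/eqP V0|/card_gt0P [v0 _]] := posnP #|V|; first by left; apply/eqP.
right; have [/existsP [T1 /existsP [T2 /and3P [tr1 tr2 n12]]]|no] :=
  boolP [exists T1, exists T2, [&& triangle F T1, triangle F T2 & T1 != T2]]; last first.
  exists v0 => T1 T2 tr1 tr2 n12; case/negP: no.
  by apply/existsP; exists T1; apply/existsP; exists T2; rewrite tr1 tr2.
have [v dv] := one _ _ tr1 tr2 n12.
have /setIP [v1 v2] : v \in T1 :&: T2 by rewrite dv set11.
(* A triangle missing [v] meets [T1] and [T2] in distinct vertices [x] and [y]; then [v], [x], [y]
   form a triangle sharing two vertices with [T1]. *)
have vT T : triangle F T -> v \in T.
  move=> tr; have [->//|n1] := eqVneq T T1; have [->//|n2] := eqVneq T T2.
  apply/negPn/negP => vT.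
  have [x dx] := one _ _ tr tr1 n1; have [y dy] := one _ _ tr tr2 n2.
  have /setIP [xT x1] : x \in T :&: T1 by rewrite dx set11.
  have /setIP [yT y2] : y \in T :&: T2 by rewrite dy set11.
  have vx : v != x by apply: contraNneq vT => ->.
  have vy : v != y by apply: contraNneq vT => ->.
  have xy : x != y.
    by apply: contraNneq vx => xy; rewrite eq_sym -in_set1 -dv inE x1 xy.
  have tr3 : triangle F [set v; x; y].
    apply/triangleP; exists v, x, y; split=> //.
    - exact: triangle_adj tr1 v1 x1 vx.
    - exact: triangle_adj tr2 v2 y2 vy.
    - exact: triangle_adj tr xT yT xy.
  have n3 : [set v; x; y] != T1.
    apply: contraNneq vy => eT; rewrite eq_sym -in_set1 -dv inE y2 andbT -eT.
    by rewrite !inE eqxx orbT.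
  have [z dz] := one _ _ tr3 tr1 n3.
  have : v \in [set z] by rewrite -dz !inE eqxx v1.
  have : x \in [set z] by rewrite -dz !inE eqxx x1 orbT.
  by move=> /set1P xz /set1P vz; rewrite xz vz eqxx in vx.
exists v => A B trA trB nAB; have [z dz] := one _ _ trA trB nAB.
by have : v \in [set z]; [rewrite -dz inE !vT|move=> /set1P ->].
Qed.

Theorem theorem1p3 (V : finType) (F : sgraph V) :
  is_O_id (fun n : nat => rex n (complete 3) F) <-> extended_friendship F.
Proof.
split; first exact: linear_rex_extended_friendship.
by move=> extF; exists (2 * #|V| * #|V|), 0 => n _; apply: rex_extended_friendship.
Qed.
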